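(* There is an absolute constant $C>0$ with the following property. Let $U$ be a finite set, let $\mathcal F\subseteq 2^U\setminus\{\varnothing\}$ be nonempty, and suppose that $\mathrm{VC}(\mathcal F)\le d$ for an integer $d\ge 1$. Then $q(\mathcal F)\le q_f(\mathcal F)\le C\,q(\mathcal F)\log(d+1)$.
   Context: $\log$ is the natural logarithm. VC dimension: a set $D\subseteq U$ is shattered by $\mathcal F$ if $\{S\cap D:S\in\mathcal F\}=2^D$; $\mathrm{VC}(\mathcal F)$ is the largest size of a set shattered by $\mathcal F$. Let $\mathcal F\subseteq 2^U\setminus\{\varnothing\}$ be nonempty. A family $\mathcal G\subseteq 2^U$ covers $\mathcal F$ if every $S\in\mathcal F$ contains some $T\in\mathcal G$ as a subset. The expectation threshold $q(\mathcal F)$ is the largest $p\in[0,1]$ for which some family $\mathcal G\subseteq2^U$ covering $\mathcal F$ satisfies $\sum_{T\in\mathcal G}p^{|T|}\le \frac12$ (with $p^0=1$). A function $\lambda:2^U\to[0,\infty)$ is a fractional cover of $\mathcal F$ if $\sum_{T\subseteq S}\lambda(T)\ge 1$ for every $S\in\mathcal F$. The fractional expectation threshold $q_f(\mathcal F)$ is the largest $p\in[0,1]$ for which there is a fractional cover $\lambda$ of $\mathcal F$ with $\sum_{T\subseteq U}\lambda(T)p^{|T|}\le\frac12$. *)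

(* Defs.v *)
From mathcomp Require Import all_boot all_order all_algebra.
From mathcomp Require Import all_classical all_reals all_analysis.
(* [all_classical] shadows [set0] and [powerset] from [finset]. *)
From mathcomp Require Import finset.

Set Implicit Arguments.
Unset Strict Implicit.
Unset Printing Implicit Defensive.

Import Order.TTheory GRing.Theory Num.Theory.
Import numFieldNormedType.Exports.
Local Open Scope ring_scope.

Section VC.
Variable U : finType.
Implicit Types (F : {set {set U}}) (D : {set U}).

Definition shattered F D : bool :=
  (fun S : {set U} => S :&: D) @: F == powerset D.

Definition VC F : nat := (\max_(D : {set U} | shattered F D) #|D|)%N.

End VC.

Section Thresholds.
Variables (R : realType) (U : finType).
Implicit Types (F G : {set {set U}}) (lam : {set U} -> R) (p : R).

Definition covers G F : Prop :=
  forall S, S \in F -> exists2 T : {set U}, T \in G & T \subset S.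

Definition fractional_cover lam F : Prop :=
  (forall T, 0 <= lam T) /\
  (forall S, S \in F -> 1 <= \sum_(T : {set U} | T \subset S) lam T).

Definition q_admissible F : set R :=
  [set p : R | 0 <= p <= 1 /\
     exists2 G, covers G F & \sum_(T in G) p ^+ #|T| <= 1 / 2]%classic.

Definition qf_admissible F : set R :=
  [set p : R | 0 <= p <= 1 /\
     exists2 lam, fractional_cover lam F &
       \sum_(T : {set U}) lam T * p ^+ #|T| <= 1 / 2]%classic.

(* The suprema below are maxima: see [q_largest] and [qf_largest]. *)
Definition q F : R := sup (q_admissible F).

Definition qf F : R := sup (qf_admissible F).

Lemma q_admissible0 F : set0 \notin F -> q_admissible F 0.
Proof.
move=> F0; split; first by rewrite lexx ler01.
exists F; first by move=> S SF; exists S.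
rewrite big1 ?divr_ge0// => T TF; rewrite expr0n cards_eq0.
by case: eqP TF => // ->; rewrite (negbTE F0).
Qed.

Lemma q_admissible_qf F : (q_admissible F `<=` qf_admissible F)%classic.
Proof.
move=> p [p01 [G GF Gp]]; split => //.
exists (fun T => (T \in G)%:R).
  split=> [T|S /GF[T TG TS]]; first exact: ler0n.
  by rewrite (bigD1 T)//= TG lerDl sumr_ge0.
rewrite (le_trans _ Gp)// [leRHS]big_mkcond/=; apply: ler_sum => T _.
by case: (T \in G); rewrite ?mul1r ?mul0r.
Qed.

Let maxE (A : set R) (c : R) :
  A c -> ubound A c -> A (sup A) /\ ubound A (sup A).
Proof.
move=> Ac cA; have hA : has_sup A by split; exists c.
suff -> : sup A = c by [].
apply/eqP; rewrite eq_le ge_sup ?ub_le_sup//; first by exists c.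
by exists c.
Qed.

Let continuous_weight (T : topologicalType) (P : pred {set U})
    (f : {set U} -> T -> R) (g : T -> R) :
  (forall i, continuous (f i)) -> continuous g ->
  continuous (fun x => \sum_(i : {set U} | P i) f i x * g x ^+ #|i|).
Proof.
move=> cf cg; apply: continuous_big => [|i _ x]; first exact: add_continuous.
apply: cvgM; first exact: cf.
apply: (@continuous_comp _ _ _ g (fun y : R => y ^+ #|i|)); first exact: cg.
exact: exprn_continuous.
Qed.

Let closed_preim (T : topologicalType) (f : T -> R) (A : set R) :
  continuous f -> closed A -> closed (f @^-1` A)%classic.
Proof. by move=> cf; apply: preimage_closed => x _; exact: cf. Qed.

Lemma q_largest F : set0 \notin F ->
  q_admissible F (q F) /\ ubound (q_admissible F) (q F).
Proof.
move=> F0.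
pose w G p : R := \sum_(T in G) (1 : R) * p ^+ #|T|.
have wE G p : \sum_(T in G) p ^+ #|T| = w G p.
  by apply: eq_bigr => T _; rewrite mul1r.
have cA : compact (q_admissible F).
  apply: (@subclosed_compact _ _ `[(0 : R), 1]%classic).
  - rewrite (_ : q_admissible F = (`[(0 : R), 1] `&`
        \bigcup_(G in [set G | covers G F]) (w G @^-1` [set x | x <= 1 / 2]))%classic).
      apply: closedI; first exact: interval_closed.
      apply: closed_bigcup => [|G _]; first exact: finite_finset.
      apply: closed_preim; last exact: closed_le.
      by apply: continuous_weight => [T|]; [exact: cst_continuous|move=> ?; exact: cvg_id].
    apply/seteqP; split => p /=.
      move=> [p01 [G GF Gp]]; split; first by rewrite in_itv.
      by exists G => //=; rewrite -wE.
    move=> [p01 [G GF Gp]]; split; first by move: p01; rewrite in_itv.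
    by exists G => //; rewrite wE.
  - exact: segment_compact.
  - by move=> p [p01 _]; rewrite /= in_itv.
have [|c] := @compact_EVT_max _ R id _ (ex_intro _ _ (q_admissible0 F0)) cA.
  by apply: continuous_subspaceT => x; exact: cvg_id.
move=> /set_mem cF cmax; apply: (maxE cF) => p pF.
by apply: cmax; apply: mem_set.
Qed.

Lemma qf_largest F : set0 \notin F ->
  qf_admissible F (qf F) /\ ubound (qf_admissible F) (qf F).
Proof.
move=> F0.
pose X := prod_topology (fun _ : option {set U} => (R : topologicalType)).
pose pr (i : option {set U}) (x : X) : R := x i.
have cpr i : continuous (pr i) by exact: proj_continuous.
pose box : set X := [set x : X | forall i, `[(0 : R), 1]%classic (x i)]%classic.
pose cov (S : {set U}) (x : X) : R :=
  \sum_(T : {set U} | T \subset S) pr (Some T) x * (1 : R) ^+ #|T|.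
have covE S x : cov S x = \sum_(T : {set U} | T \subset S) x (Some T).
  by apply: eq_bigr => T _; rewrite expr1n mulr1.
pose cost (x : X) : R :=
  \sum_(T : {set U} | true) pr (Some T) x * pr None x ^+ #|T|.
pose K : set X := (box `&` (cost @^-1` [set y | (y <= 1 / 2)%R] `&`
  \bigcap_(S in [set S | S \in F]) (cov S @^-1` [set y | (1 <= y)%R])))%classic.
have cK : compact K.
  apply: compact_closedI.
    apply: (@tychonoff _ (fun=> (R : topologicalType)) (fun=> `[(0 : R), 1]%classic)).
    by move=> _; exact: segment_compact.
  apply: closedI.
    apply: closed_preim; last exact: closed_le.
    by apply: continuous_weight => [T|]; exact: cpr.
  apply: closed_bigI => S _; apply: closed_preim; last exact: closed_ge.
  apply: continuous_weight => [T|]; first exact: cpr.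
  exact: cst_continuous.
have KE p : qf_admissible F p <-> exists2 x, K x & x None = p.
  split=> [[p01 [lam [lam0 lamF] lamp]]|[x [xb [xc xF]] <-]]; last first.
    split; first by have := xb None; rewrite /= in_itv.
    exists (fun T => x (Some T)); last exact: xc.
    split=> [T|S SF]; first by have := xb (Some T); rewrite /= in_itv => /andP[].
    by have := xF S SF; rewrite /= covE.
  pose x : X := fun i => if i is Some T then Num.min (lam T) 1 else p.
  have x0 T : 0 <= Num.min (lam T) 1 by rewrite le_min lam0 ler01.
  exists x => //; split.
    case=> [T|] /=; rewrite in_itv /=; last exact: p01.
    by rewrite x0 ge_min lexx orbT.
  split.
    apply: (le_trans _ lamp); apply: ler_sum => T _.
    rewrite ler_wpM2r ?exprn_ge0 ?ge_min ?lexx//.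
    by case/andP: p01.
  move=> S /= SF; rewrite covE.
  have [/existsP[T /andP[TS T1]]|/existsPn lam1] :=
      boolP [exists T : {set U}, (T \subset S) && (1 <= lam T)].
    rewrite (bigD1 T)//= /pr /= min_r// lerDl.
    by apply: sumr_ge0 => i _; exact: x0.
  rewrite (le_trans (lamF S SF))//; apply: ler_sum => T TS.
  by have := lam1 T; rewrite TS -ltNge => /ltW T1; rewrite /pr /= min_l.
have K0 : (K !=set0)%classic.
  by have /KE[x xK _] := q_admissible_qf (q_admissible0 F0); exists x.
have [|x] := @compact_EVT_max _ R (pr None) _ K0 cK.
  exact: continuous_subspaceT.
move=> /set_mem xK xmax; apply: (@maxE _ (x None)); first by apply/KE; exists x.
by move=> p /KE[y yK <-]; apply: xmax; apply: mem_set.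
Qed.

End Thresholds.

(* Main.v *)
Require Import Defs.
From mathcomp Require Import all_boot all_order all_algebra.
From mathcomp Require Import all_classical all_reals all_analysis.
From mathcomp Require Import finset.
From mathcomp Require Import zify ring lra.

(* Splitting a fractional cover lam by the size t of its sets, and losing a constant
   factor in p, one may assume that lam lives on t-sets and that its cost is at most
   256 ^ - t. Put s = (d + 1) d t, and call a set V with fewer than s points heavy if
   the subsets of V carry lam-weight at least 1/2.

   Members of F containing a heavy set: it is enough to cover the heavy sets, whose
   size is at most 2 ^ k t with k = O(log (d + 1)). As in the Park-Pham argument,
   minimal fragments V :\: W with respect to a random set W either are large, and
   then form a cheap cover, or halve the size bound, so k rounds bring it down to t.
   There all fragments are cheap: their expected cost is at most 2 ^ t times the
   probability that the random set contains a heavy set, which is bounded by the cost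
   of lam, at most 256 ^ - t.

   Other members S of F: the union Z of O(s |lam|) sets sampled from lam meets S in at
   least s points with probability at least 1/2, and by Sauer-Shelah Z has only
   (s |lam|) ^ O(d) traces. Choosing an s-subset in each large trace yields a new
   fractional cover by s-sets, whose cost is again at most 256 ^ - s at the same p;
   since s > t the process stops. *)

Set Implicit Arguments.
Unset Strict Implicit.
Unset Printing Implicit Defensive.

Import Order.TTheory GRing.Theory Num.Theory.

(** * The Sauer-Shelah lemma *)

Section SauerShelah.
Variable U : finType.
Implicit Types (F : {set {set U}}) (D E S Z : {set U}).

Lemma shatteredP F D :
  reflect (forall E, E \subset D -> exists2 S, S \in F & S :&: D = E)
          (shattered F D).
Proof.
apply: (iffP eqP) => [FD E ED|FD].
  have : E \in powerset D by rewrite powersetE.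
  by rewrite -FD => /imsetP[S SF ->]; exists S.
apply/setP => E; rewrite powersetE; apply/imsetP/idP => [[S _ ->]|/FD[S SF SE]].
  exact: subsetIr.
by exists S.
Qed.

Lemma card_le_VC F D : shattered F D -> #|D| <= VC F.
Proof. by move=> FD; rewrite /VC (bigop.leq_bigmax_cond D). Qed.

Lemma VC_le F d : (forall D, shattered F D -> #|D| <= d) -> VC F <= d.
Proof. by move=> Fd; apply/bigop.bigmax_leqP. Qed.

Lemma VC_sub F F' : F \subset F' -> VC F <= VC F'.
Proof.
move=> FF'; apply: VC_le => D /shatteredP FD; apply: card_le_VC.
apply/shatteredP => E /FD[S SF SE]; exists S => //.
exact: (fintype.subsetP FF').
Qed.

(** Induction after splitting [F] at a point [x] where two members differ. Sets shattered by either
    half avoid [x]; a set [D] shattered by both is counted twice, and its second copy is charged to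
    [x |: D], which [F] also shatters. *)
Lemma card_le_shattered F : #|F| <= #|[set D | shattered F D]|.
Proof.
have [n] := ubnP #|F|; elim: n F => // n IH F.
have [|] := leqP #|F| 1.
  rewrite leq_eqVlt ltnS leqn0 => /orP[/cards1P[S ->] _|/eqP -> //].
  rewrite cards1 card_gt0; apply/set0Pn; exists set0; rewrite inE.
  apply/shatteredP => E; rewrite subset0 => /eqP ->.
  by exists S; rewrite ?set11 ?setI0.
move=> /card_gt1P[A [B [AF BF AB]]] Fn.
wlog /subsetPn[x xA xB] : A B AF BF AB / ~~ (A \subset B).
  move=> H; have [sAB|/H] := boolP (A \subset B); last exact.
  have [sBA|/H] := boolP (B \subset A); last by apply; rewrite // eq_sym.
  by move: AB; rewrite eqEsubset sAB sBA.
pose F1 := [set S in F | x \in S]; pose F0 := [set S in F | x \notin S].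
have cF : #|F| = #|F0| + #|F1|.
  rewrite -(cardsID [set S : {set U} | x \in S] F) addnC; congr (_ + _).
    by apply: eq_card => S; rewrite !inE andbC.
  by apply: eq_card => S; rewrite !inE.
have F0gt : 0 < #|F0| by apply/card_gt0P; exists B; rewrite inE BF.
have F1gt : 0 < #|F1| by apply/card_gt0P; exists A; rewrite inE AF.
pose Sh (G : {set {set U}}) := [set D | shattered G D].
have xSh0 D : D \in Sh F0 -> x \notin D.
  rewrite inE => /shatteredP/(_ _ (subxx D))[S]; rewrite inE => /andP[_ xS] <-.
  by rewrite inE negb_and xS.
have xSh1 D : D \in Sh F1 -> x \notin D.
  rewrite inE => /shatteredP/(_ _ (sub0set D))[S]; rewrite inE => /andP[_ xS].
  by move=> /setP/(_ x); rewrite !inE xS => /= ->.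
have F0n : #|F0| < n by rewrite -ltnS (leq_trans _ Fn)// cF ltnS -addn1 leq_add2l.
have F1n : #|F1| < n by rewrite -ltnS (leq_trans _ Fn)// cF ltnS -add1n leq_add2r.
rewrite cF (leq_trans (leq_add (IH _ F0n) (IH _ F1n)))// -/(Sh _) -/(Sh _).
rewrite -cardsUI -[X in (_ + X)%N](card_in_imset (f := fun D => x |: D)); last first.
  move=> D E /setIP[/xSh0 xD _] /setIP[/xSh0 xE _].
  by move=> /(congr1 (fun V => V :\ x)); rewrite !setU1K.
rewrite -cardsUI (_ : _ :&: [set x |: _ | _ in _] = set0) ?cards0 ?addn0; last first.
  apply/setP => D; rewrite !inE; apply/negP => /andP[D01  /imsetP[E _ DE]].
  have : x \in D by rewrite DE setU11.
  by apply/negP; case/orP: D01 => D01; [apply: xSh0|apply: xSh1]; rewrite inE.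
apply: subset_leq_card; apply/fintype.subsetP => D; rewrite !inE => /orP[/orP[]|].
- by move=> /shatteredP FD; apply/shatteredP => E /FD[S]; rewrite inE => /andP[SF _]; exists S.
- by move=> /shatteredP FD; apply/shatteredP => E /FD[S]; rewrite inE => /andP[SF _]; exists S.
case/imsetP=> D'; rewrite !inE => /andP[/shatteredP D0 /shatteredP D1] ->.
apply/shatteredP => E ED.
have ED' : E :\ x \subset D' by rewrite subDset.
have [xE|xE] := boolP (x \in E).
  have [S] := D1 _ ED'; rewrite inE => /andP[SF xS] SD; exists S => //.
  by rewrite setIUr SD (setIidPr _) ?sub1set// setD1K.
have [S] := D0 _ ED'; rewrite inE => /andP[SF xS] SD; exists S => //.
rewrite setIUr SD (_ : S :&: [set x] = set0) ?set0U; last first.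
  by apply/eqP; rewrite setI_eq0 disjoint_sym disjoints1.
by apply/setDidPl; rewrite disjoint_sym disjoints1.
Qed.

Lemma card_small_subsets Z d :
  #|[set D : {set U} | D \subset Z & #|D| <= d]| <= #|Z|.+1 ^ d.
Proof.
elim: d => [|d IH].
  rewrite expn0 -(cards1 (set0 : {set U})); apply: subset_leq_card.
  by apply/fintype.subsetP => D; rewrite !inE leqn0 cards_eq0 => /andP[].
have IHd : 'C(#|Z|, d) <= #|Z|.+1 ^ d.
  apply: leq_trans IH; rewrite -cards_draws; apply: subset_leq_card.
  by apply/fintype.subsetP => D; rewrite !inE => /andP[-> /eqP ->]/=.
rewrite (_ : [set D : {set U} | _ & _] =
  [set D : {set U} | D \subset Z & #|D| <= d] :|:
  [set D : {set U} | D \subset Z & #|D| == d.+1]); last first.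
  by apply/setP => D; rewrite !inE -andb_orr leq_eqVlt orbC.
rewrite (leq_trans (leq_card_setU _ _))// cards_draws expnS mulSn leq_add//.
rewrite -(leq_pmul2l (ltn0Sn d)) mul_bin_left (leq_trans (leq_mul (leq_subr _ _) IHd))//.
by rewrite leq_pmull.
Qed.

(** Whatever the family of traces on [Z] shatters lies in [Z] and is already shattered by [F]. *)
Lemma sauer_shelah F Z : #|[set S :&: Z | S in F]| <= #|Z|.+1 ^ VC F.
Proof.
apply: leq_trans (card_small_subsets Z (VC F)).
apply: leq_trans (card_le_shattered _) _; apply: subset_leq_card.
apply/fintype.subsetP => D; rewrite !inE => /shatteredP FD.
have DZ : D \subset Z.
  have [_ /imsetP[S _ ->]] := FD _ (subxx D).
  by move=> /setIidPr DSZ; apply: fintype.subset_trans DSZ (subsetIr _ _).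
rewrite DZ /=; apply: card_le_VC; apply/shatteredP => E /FD[_ /imsetP[S SF ->] SE].
by exists S => //; rewrite -SE -setIA (setIidPr DZ).
Qed.

End SauerShelah.

(** Numerical core of [lift_weight]. As [d.+1 <= 2 * d], twice the base is at most
    [24 * (d * t) ^ 2], and [x ^ 2 <= 4 ^ x] leaves a factor 64 to absorb the 24. *)
Lemma lift_size_bound d t : (0 < d)%N -> (0 < t)%N ->
  (2 * (6 * t * (d.+1 * d * t)) ^ d <= 256 ^ (d ^ 2 * t))%N.
Proof.
move=> d0 t0; have dt0 : (0 < d * t)%N by rewrite muln_gt0 d0.
have x4 x : (x ^ 2 <= 4 ^ x)%N.
  by rewrite (_ : 4 = 2 ^ 2)%N// -expnM mulnC expnM leq_exp2r// ltnW// ltn_expl.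
have e : (2 * (6 * t * (d.+1 * d * t)) <= 256 ^ (d * t))%N.
  apply: (@leq_trans (24 * (d * t) ^ 2)); first by rewrite !expnS expn0; nia.
  rewrite (_ : 256 = 64 * 4)%N// (expnMn 64); apply: leq_mul => //.
  by apply: (@leq_trans (64 ^ 1)) => //; apply: leq_pexp2l.
apply: (@leq_trans ((2 * (6 * t * (d.+1 * d * t))) ^ d)).
  by rewrite (expnMn 2); apply: leq_mul => //; rewrite -[leqLHS]expn1; apply: leq_pexp2l.
rewrite (_ : d ^ 2 * t = d * t * d)%N; last by rewrite !expnS expn0; nia.
by rewrite expnM leq_exp2r.
Qed.

Local Open Scope ring_scope.

(** * Fragments with respect to a random set *)

Section RandomSet.
Variables (R : realFieldType) (U : finType).
Implicit Types (T V W Z : {set U}) (H : {set {set U}}).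

(** The probability that the random subset containing each point independently with probability [r]
    equals [W]. *)
Definition rset (r : R) W : R := \prod_u (if u \in W then r else 1 - r).

Lemma rset_ge0 r W : 0 <= r <= 1 -> 0 <= rset r W.
Proof.
by move=> /andP[r0 r1]; apply: prodr_ge0 => u _; case: ifP; rewrite ?subr_ge0.
Qed.

Lemma prod_if_in T (a : R) : \prod_u (if u \in T then a else 1) = a ^+ #|T|.
Proof. by rewrite -big_mkcond prodr_const. Qed.

(** By independence each point of [T] contributes a factor 1 if it is hit and [x] if not. Taking [x]
    to be 1 or 0 gives the total mass and the probability of containing [T]. *)
Lemma sum_rset_exp r x T :
  \sum_W rset r W * x ^+ #|T :\: W| = (r + (1 - r) * x) ^+ #|T|.
Proof.
pose G u := (1 - r) * (if u \in T then x else 1).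
rewrite -prod_if_in (eq_bigr (fun u => r + G u)); last first.
  by move=> u _; rewrite /G; case: ifP => _; rewrite // mulr1 addrC subrK.
rewrite bigA_distr; apply: eq_bigr => W _.
rewrite -prod_if_in -big_split /=; apply: eq_bigr => u _.
by rewrite /G inE; case: (u \in W); rewrite ?mulr1.
Qed.

Lemma sum_rset r : \sum_W rset r W = 1.
Proof.
have := sum_rset_exp r 1 set0; rewrite cards0 expr0 => s1; rewrite -[RHS]s1.
by apply: eq_bigr => W _; rewrite set0D cards0 expr0 mulr1.
Qed.

Lemma sum_rset_sub r T : \sum_W rset r W * (T \subset W)%:R = r ^+ #|T|.
Proof.
have := sum_rset_exp r 0 T; rewrite mulr0 addr0 => <-.
by apply: eq_bigr => W _; rewrite expr0n cards_eq0 setD_eq0.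
Qed.

Lemma rset_setU r T W : 0 <= r <= 1 -> [disjoint T & W] ->
  rset r W * r ^+ #|T| <= rset r (W :|: T).
Proof.
move=> /andP[r0 r1] TW; rewrite -prod_if_in -big_split /=.
apply: ler_prod => u _; rewrite inE.
case: (boolP (u \in W)) => uW; case: (boolP (u \in T)) => uT /=.
- by have := disjointFr TW uT; rewrite uW.
- by rewrite mulr1 r0 lexx.
- by rewrite mulr_ge0 ?subr_ge0//= ler_piMl// lerBlDr lerDl.
- by rewrite mulr1 lexx subr_ge0 r1.
Qed.

Lemma exists_le_mean (I : finType) (w f : I -> R) c :
  (forall i, 0 <= w i) -> \sum_i w i = 1 -> \sum_i w i * f i <= c ->
  exists i, f i <= c.
Proof.
move=> w0 w1 fc; apply/existsP; apply: contraT => /existsPn fgt.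
have f0 i : true -> 0 <= w i * (f i - c).
  by rewrite mulr_ge0// subr_ge0 ltW// ltNge.
have sf : \sum_i w i * (f i - c) = 0.
  apply/eqP; rewrite eq_le sumr_ge0// andbT.
  under eq_bigr do rewrite mulrBr.
  by rewrite sumrB -mulr_suml w1 mul1r subr_le0.
have : \sum_i w i = 0.
  apply: big1 => i _; move: (psumr_eq0P f0 sf (i := i) isT) => /eqP.
  by rewrite mulf_eq0 subr_eq0 => /orP[/eqP //|/eqP fi]; have := fgt i; rewrite fi lexx.
by rewrite w1 => /eqP; rewrite oner_eq0.
Qed.

Definition fragments H W : {set {set U}} :=
  [set T | minset [in [set V :\: W | V in H]] T].

Lemma fragments_cover H W V : V \in H ->
  exists2 T, T \in fragments H W & T \subset V :\: W.
Proof.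
move=> VH; have [|T mT TV] := @minset_exists _ [in [set V :\: W | V in H]] (V :\: W).
  by apply: imset_f.
by exists T; rewrite ?inE.
Qed.

Lemma fragmentsP H W T : T \in fragments H W ->
  exists2 V, V \in H & T = V :\: W.
Proof. by rewrite inE => /minsetp/imsetP. Qed.

(** [V :\: W] lies in [T], so minimality makes them equal. This is what limits the fragments
    compatible with a given union [W :|: T]. *)
Lemma fragments_min H W T V : T \in fragments H W -> V \in H ->
  V \subset W :|: T -> T \subset V.
Proof.
rewrite inE => /minsetP[_ minT] VH VWT.
rewrite -(minT (V :\: W)) ?subsetDl//; first exact: imset_f.
by rewrite subDset.
Qed.

Lemma sum_pow_subsets (a : R) V l s : 0 <= a <= 1 -> (#|V| <= l)%N ->
  \sum_(T : {set U} | (T \subset V) && (s <= #|T|)%N) a ^+ #|T| <= 2 ^+ l * a ^+ s.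
Proof.
move=> /andP[a0 a1] Vl.
apply: (@le_trans _ _ (\sum_(T in powerset V) a ^+ s)).
  rewrite [leLHS]big_mkcond [leRHS]big_mkcond; apply: ler_sum => T _.
  rewrite powersetE; case: (T \subset V) => //=; case: ifP => sT.
    exact: ler_wiXn2l.
  exact: exprn_ge0.
rewrite sumr_const card_powerset -[leLHS]mulr_natl natrX ler_wpM2r ?exprn_ge0//.
by rewrite ler_weXn2l// ler1n.
Qed.

(* Encode the pair (W, T), for T a fragment of H with respect to W, by
   Z = W :|: T and T: since Z contains a member of H, and T is contained in each
   such member, at most 2 ^ l sets T are compatible with a given Z. *)
Lemma fragments_cost (L q : R) H l s : 1 <= L -> 0 <= q -> L * q <= 1 ->
    (forall V, V \in H -> (#|V| <= l)%N) ->
  \sum_W rset (L * q) W *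
      \sum_(T in fragments H W | (s <= #|T|)%N) q ^+ #|T|
    <= 2 ^+ l * L^-1 ^+ s *
       \sum_Z rset (L * q) Z * [exists V in H, V \subset Z]%:R.
Proof.
move=> L1 q0 Lq1 Hl; set r := L * q.
have L0 : 0 < L by apply: lt_le_trans L1.
have r01 : 0 <= r <= 1 by rewrite Lq1 mulr_ge0// ltW.
have Li : 0 <= L^-1 <= 1 by rewrite invr_ge0 ltW//= invf_le1.
have qE : q = r * L^-1 by rewrite /r mulrAC divff ?mul1r// lt0r_neq0.
pose ex Z := [exists V in H, V \subset Z].
(* A member of [H] inside [Z] that depends on [Z] alone; the default is only taken when [ex Z]
   fails. *)
pose phi Z := odflt set0 [pick V in H | V \subset Z].
have phiP Z : ex Z -> phi Z \in H /\ phi Z \subset Z.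
  rewrite /phi; case: pickP => [V /andP[VH VZ] _|nV]; first by [].
  by move=> /existsP[V]; rewrite nV.
pose P T Z := [&& ex Z, T \subset phi Z & (s <= #|T|)%N].
apply: (@le_trans _ _ (\sum_T \sum_(Z | P T Z) rset r Z * L^-1 ^+ #|T|)).
  rewrite (eq_bigr (fun W => \sum_(T in fragments H W | (s <= #|T|)%N)
      rset r W * q ^+ #|T|)); last by move=> W _; rewrite mulr_sumr.
  rewrite (exchange_big_dep xpredT)//=; apply: ler_sum => T _.
  pose A := [set W | T \in fragments H W & (s <= #|T|)%N].
  have AP W : W \in A -> [disjoint T & W] /\ P T (W :|: T).
    rewrite inE => /andP[TW sT]; have [V VH VT] := fragmentsP TW.
    split.
      by rewrite VT -setI_eq0 setIC setDE setIA setIAC setICr set0I.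
    have exZ : ex (W :|: T).
      by apply/existsP; exists V; rewrite VH VT -subDset subxx.
    rewrite /P exZ sT andbT/=; have [pH pZ] := phiP _ exZ.
    exact: fragments_min TW pH pZ.
  (* Write [q] as [r / L]: the power of [r] turns the weight of [W] into at most that of [W :|: T].
     For fixed [T] the union determines [W], the two being disjoint. *)
  apply: (@le_trans _ _ (\sum_(W in A) rset r (W :|: T) * L^-1 ^+ #|T|)).
    rewrite (eq_bigl (fun W => W \in A)) => [|W]; last by rewrite [RHS]inE.
    apply: ler_sum => W /AP[TW _].
    rewrite qE exprMn mulrA ler_wpM2r ?exprn_ge0//; first by case/andP: Li.
    exact: rset_setU.
  rewrite -(big_imset (fun Z => rset r Z * L^-1 ^+ #|T|) (h := fun W => W :|: T)) /=.
    rewrite [leLHS]big_mkcond [leRHS]big_mkcond; apply: ler_sum => Z _.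
    case: ifP => [/imsetP[W /AP[_ PT] ->]|_]; first by rewrite PT.
    by case: ifP => // _; rewrite mulr_ge0 ?rset_ge0// exprn_ge0//; case/andP: Li.
  move=> W W' /AP[dW _] /AP[dW' _] /(congr1 (fun Z => Z :\: T)).
  by rewrite !setDUl setDv !setU0 !(setDidPl _) 1?disjoint_sym.
rewrite (exchange_big_dep xpredT)//= mulr_sumr; apply: ler_sum => Z _.
rewrite -mulr_sumr mulrCA ler_wpM2l ?rset_ge0//.
rewrite /P -/(ex Z); case exZ: (ex Z) => /=; last first.
  by rewrite big_pred0// mulr0.
by rewrite mulr1 sum_pow_subsets// Hl//; case: (phiP _ exZ).
Qed.

End RandomSet.

Lemma sum_setU_le (R : realFieldType) (T : finType) (A B : {set T}) (f : T -> R) :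
  (forall x, 0 <= f x) ->
  \sum_(x in A :|: B) f x <= \sum_(x in A) f x + \sum_(x in B) f x.
Proof.
move=> f0; rewrite [leLHS]big_mkcond [X in _ <= X + _]big_mkcond.
rewrite [X in _ <= _ + X]big_mkcond -big_split; apply: ler_sum => x _ /=.
by rewrite inE; case: (x \in A); case: (x \in B); rewrite /= ?addr0 ?add0r// lerDl.
Qed.

(** * Integral covers of families of sets of bounded size *)

Section BoundedCover.
Variables (R : realFieldType) (U : finType) (q : R) (t : nat).
Hypotheses (q0 : 0 <= q) (q1 : 256 * q <= 1) (t0 : (0 < t)%N).
Implicit Types (H G : {set {set U}}) (V W Z : {set U}).

Let r01 : 0 <= 256 * q <= 1. Proof. by rewrite q1 mulr_ge0. Qed.
Let L1 : 1 <= 256 :> R. Proof. by rewrite ler1n. Qed.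

(** Induction on [k]; the first error term sums the costs [64^-1 ^+ t * 2^-1 ^+ j] of the large
    fragments over the rounds. The sets are indexed by [I] because distinct [T i] may coincide once
    [W] is removed. *)
Lemma cover_bounded k (I : finType) (T : I -> {set U}) (lam : I -> R) H :
    (forall V, V \in H -> (#|V| <= 2 ^ k * t)%N) ->
    (forall i, 0 <= lam i) ->
    (forall V, V \in H -> 1 <= \sum_(i | T i \subset V) lam i) ->
  exists2 G, covers G H &
    \sum_(X in G) q ^+ #|X| <=
      2 * 64^-1 ^+ t * (1 - 2^-1 ^+ k) +
      2 ^+ t * \sum_i lam i * (256 * k.+1%:R * q) ^+ #|T i|.
Proof.
elim: k I T lam H => [|k IH] I T lam H Hk lam0 lamH.
  have Ht V : V \in H -> (#|V| <= t)%N by move=> /Hk; rewrite mul1n.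
  rewrite expr0 subrr mulr0 add0r mulr1.
  have : \sum_W rset (256 * q) W *
      (\sum_(X in fragments H W | (0 <= #|X|)%N) q ^+ #|X|) <=
      2 ^+ t * \sum_i lam i * (256 * q) ^+ #|T i|.
    apply: le_trans (fragments_cost 0 L1 q0 q1 Ht) _.
    rewrite expr0 mulr1 ler_wpM2l ?exprn_ge0//.
    (* The indicator that [Z] contains a member of [H] is at most the [lam]-weight of the [T i]
       inside [Z], whose mean is the cost of [lam]. *)
    rewrite (eq_bigr (fun i => \sum_Z rset (256 * q) Z *
        (lam i * (T i \subset Z)%:R))); last first.
      move=> i _; rewrite -sum_rset_sub mulr_sumr.
      by apply: eq_bigr => Z _; rewrite mulrCA.
    rewrite exchange_big/=; apply: ler_sum => Z _; rewrite -mulr_sumr.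
    apply: ler_wpM2l; first exact: rset_ge0.
    have s0 : 0 <= \sum_i lam i * (T i \subset Z)%:R.
      by apply: sumr_ge0 => i _; rewrite mulr_ge0.
    case: existsP => //= -[V /andP[VH VZ]]; apply: le_trans (lamH V VH) _.
    rewrite big_mkcond/=; apply: ler_sum => i _; case: ifP => TV.
      by rewrite (fintype.subset_trans TV VZ) mulr1.
    by rewrite mulr_ge0.
  move/(exists_le_mean (fun W => rset_ge0 W r01) (sum_rset U _)) => [W WG].
  exists (fragments H W); last by move: WG; rewrite (eq_bigl [in fragments H W])// => X; rewrite andbT.
  move=> V VH; have [X XF XV] := fragments_cover W VH.
  by exists X => //; apply: fintype.subset_trans XV (subsetDl _ _).
pose s := (2 ^ k * t)%N.
(* Large fragments will cost at most [64^-1 ^+ s], hence at most [64^-1 ^+ t * 2^-1 ^+ k]. *)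
have ks : (k + t <= s)%N.
  rewrite /s; have := ltn_expl k (isT : (1 < 2)%N); nia.
pose p : R := 256 * k.+1%:R * q.
have p0 : 0 <= p by rewrite /p !mulr_ge0.
(* A single [W] must make both the large fragments and the reduced fractional cover cheap, so the
   sum of the two costs is averaged. *)
have : \sum_W rset (256 * q) W *
    (\sum_(X in fragments H W | (s <= #|X|)%N) q ^+ #|X| +
     2 ^+ t * \sum_i lam i * p ^+ #|T i :\: W|) <=
    64^-1 ^+ t * 2^-1 ^+ k +
    2 ^+ t * \sum_i lam i * (256 * k.+2%:R * q) ^+ #|T i|.
  under eq_bigr do rewrite mulrDr.
  rewrite big_split/=; apply: lerD.
    have Hs V : V \in H -> (#|V| <= s + s)%N.
      by move=> /Hk; rewrite expnS mulSn mul1n mulnDl.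
    apply: le_trans (fragments_cost s L1 q0 q1 Hs) _.
    apply: (@le_trans _ _ (64^-1 ^+ s * 1)).
      rewrite exprD -!exprMn (_ : 2 * 2 / 256 = 64^-1 :> R); last by lra.
      rewrite ler_wpM2l ?exprn_ge0 ?invr_ge0// -[leRHS](sum_rset U (256 * q)).
      apply: ler_sum => Z _; rewrite ler_piMr ?rset_ge0//.
      by case: existsP.
    rewrite mulr1; apply: (@le_trans _ _ (64^-1 ^+ (t + k))).
      by apply: ler_wiXn2l; rewrite 1?addnC//; lra.
    rewrite exprD ler_wpM2l ?exprn_ge0 ?invr_ge0//.
    by apply: lerXn2r; rewrite ?nnegrE; lra.
  rewrite (eq_bigr (fun W => 2 ^+ t * \sum_i lam i *
      (rset (256 * q) W * p ^+ #|T i :\: W|))); last first.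
    by move=> W _; rewrite mulrCA; congr (_ * _); rewrite mulr_sumr; apply: eq_bigr => i _; rewrite mulrCA.
  rewrite -mulr_sumr ler_wpM2l ?exprn_ge0// exchange_big/=.
  apply: ler_sum => i _; rewrite -mulr_sumr ler_wpM2l// sum_rset_exp.
  apply: lerXn2r; rewrite ?nnegrE ?addr_ge0 ?mulr_ge0 ?subr_ge0//.
  rewrite [X in _ <= X](_ : _ = 256 * q + p); last by rewrite /p -natr1; ring.
  by rewrite lerD2l ler_piMl// lerBlDr lerDl mulr_ge0.
move/(exists_le_mean (fun W => rset_ge0 W r01) (sum_rset U _)) => [W WG].
pose H1 := [set X in fragments H W | (#|X| < s)%N].
pose G1 := [set X in fragments H W | (s <= #|X|)%N].
have [X||G2 G2H G2q] := IH I (fun i => T i :\: W) lam H1 _ lam0.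
- by rewrite in_set => /andP[_ /ltnW].
- move=> X; rewrite in_set => /andP[/fragmentsP[V VH ->] _].
  apply: le_trans (lamH V VH) _.
  rewrite [leLHS]big_mkcond [leRHS]big_mkcond; apply: ler_sum => i _.
  by case: ifP => [TV|_]; [rewrite setSD|case: ifP].
exists (G1 :|: G2).
  move=> V VH; have [X XF XV] := fragments_cover W VH.
  have XV' : X \subset V by apply: fintype.subset_trans XV (subsetDl _ _).
  have [sX|sX] := leqP s #|X|; first by exists X => //; rewrite in_setU in_set XF sX.
  have [|Y YG YX] := G2H X; first by rewrite in_set XF.
  by exists Y; rewrite ?in_setU ?YG ?orbT//; apply: fintype.subset_trans YX XV'.
apply: (@le_trans _ _ (\sum_(X in G1) q ^+ #|X| + \sum_(X in G2) q ^+ #|X|)).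
  by apply: sum_setU_le => X; apply: exprn_ge0.
rewrite [X in X + _](eq_bigl (fun X => (X \in fragments H W) && (s <= #|X|)%N)); last first.
  by move=> X; rewrite [LHS]in_set.
apply: le_trans (lerD (lexx _) G2q) _; rewrite -/p.
have e : 2^-1 ^+ k = 2 * 2^-1 ^+ k.+1 :> R by rewrite exprS mulrA divff ?mul1r.
by rewrite e in WG *; lra.
Qed.

End BoundedCover.

(** * Lifting a fractional cover to larger sets *)

Section Sampling.
Variables (R : realFieldType) (U : finType) (w : {set U} -> R).
Hypotheses (w0 : forall T, 0 <= w T) (w1 : \sum_T w T = 1).
Implicit Types (f g : {set U} -> R) (S T V Z : {set U}).

(* Conditional expectation of f, given that the current union is Z, after one
   more set is drawn from w. *)
Definition draw f Z : R := \sum_T w T * f (Z :|: T).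

Let mean_const c : \sum_T w T * c = c.
Proof. by rewrite -mulr_suml w1 mul1r. Qed.

Lemma iter_draw_le m f g : (forall Z, f Z <= g Z) ->
  forall Z, iter m draw f Z <= iter m draw g Z.
Proof.
move=> fg; elim: m => //= m IH Z.
by apply: ler_sum => T _; rewrite ler_wpM2l.
Qed.

Lemma iter_draw_const m (c : R) Z : iter m draw (fun=> c) Z = c.
Proof.
elim: m Z => //= m IH Z; rewrite /draw.
by under eq_bigr do rewrite IH; exact: mean_const.
Qed.

Lemma iter_draw_ge0 m f Z : (forall Z, 0 <= f Z) -> 0 <= iter m draw f Z.
Proof. by move=> f0; rewrite -(iter_draw_const m 0 Z); apply: iter_draw_le. Qed.

Lemma iter_draw_lin m (a b : R) f g Z :
  iter m draw (fun Z => a * f Z + b * g Z) Z =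
  a * iter m draw f Z + b * iter m draw g Z.
Proof.
elim: m Z => //= m IH Z; rewrite /draw 2!mulr_sumr -big_split/=.
by apply: eq_bigr => T _; rewrite IH; ring.
Qed.

Lemma iter_draw_sum m (I : finType) (P : pred I) (f : I -> {set U} -> R) Z :
  iter m draw (fun Z => \sum_(i | P i) f i Z) Z =
  \sum_(i | P i) iter m draw (f i) Z.
Proof.
elim: m Z => //= m IH Z; rewrite /draw exchange_big/=.
by apply: eq_bigr => T _; rewrite IH mulr_sumr.
Qed.

Lemma iter_draw_card m t d f : (forall T, w T != 0 -> #|T| = t) ->
    (forall Z, f Z <= (#|Z|.+1 ^ d)%:R) ->
  forall Z, iter m draw f Z <= ((#|Z| + m * t).+1 ^ d)%:R.
Proof.
move=> wt fd; elim: m => [|m IH] Z /=; first by rewrite mul0n addn0.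
rewrite -[leRHS]mean_const; apply: ler_sum => T _.
have [->|/wt Tt] := eqVneq (w T) 0; first by rewrite !mul0r.
rewrite ler_wpM2l// (le_trans (IH _))// ler_nat.
have [->|d0] := posnP d; first by rewrite !expn0.
rewrite leq_exp2r// ltnS mulSn addnA leq_add2r -Tt.
exact: leq_card_setU.
Qed.

(* While fewer than s points of S are collected, each draw decreases the expected
   number of missing points by at least e. *)
Lemma iter_draw_hit (S : {set U}) s m (e : R) : 0 <= e ->
    (forall V, V \subset S -> (#|V| < s)%N ->
       e <= \sum_(T : {set U} | (T \subset S) && ~~ (T \subset V)) w T) ->
  m%:R * e * iter m draw (fun Z => (#|S :&: Z| < s)%N%:R) set0 <= s%:R.
Proof.
move=> e0 eS; pose g Z : R := (#|S :&: Z| < s)%N%:R.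
pose h Z : R := (s - #|S :&: Z|)%N%:R.
have mono Z T : (#|S :&: Z| <= #|S :&: (Z :|: T)|)%N.
  by apply: subset_leq_card; rewrite setIS// subsetUl.
have g_anti Z T : g (Z :|: T) <= g Z.
  rewrite /g ler_nat; case: (ltnP #|S :&: (Z :|: T)| s) => //.
  by move=> /(leq_ltn_trans (mono Z T)) ->.
have gm n Z : iter n draw g Z <= g Z.
  elim: n Z => //= n IH Z; rewrite -[leRHS]mean_const.
  by apply: ler_sum => T _; rewrite ler_wpM2l// (le_trans (IH _)).
have hstep Z : draw h Z + e * g Z <= h Z.
  have hle T : h (Z :|: T) <= h Z by rewrite ler_nat leq_sub2l.
  rewrite /g; case: ltnP => SZ; rewrite ?mulr0 ?addr0 ?mulr1; last first.
    rewrite -[leRHS]mean_const.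
    by apply: ler_sum => T _; rewrite ler_wpM2l.
  rewrite -lerBrDr -[h Z]mean_const.
  apply: le_trans (lerB (lexx _) (eS (S :&: Z) (subsetIl _ _) SZ)).
  rewrite [X in _ <= _ - X]big_mkcond -sumrB; apply: ler_sum => T _ /=.
  case: ifP => [/andP[TS TZ]|_]; last by rewrite subr0 ler_wpM2l.
  rewrite -[X in _ - X]mulr1 -mulrBr ler_wpM2l// lerBrDr /h natr1 ler_nat.
  suff : (#|S :&: Z| < #|S :&: (Z :|: T)|)%N by move: SZ; lia.
  apply: proper_card; rewrite properE setIS ?subsetUl//=.
  apply: contra TZ => /(fintype.subset_trans _); apply.
  by rewrite subsetI TS subsetUr.
have claim n Z : n%:R * e * iter n draw g Z + 1 * iter n draw h Z <= h Z.
  elim: n Z => [|n IH] Z /=; first by rewrite !mul0r mul1r add0r.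
  rewrite -natr1 -/(draw _ _) 2!mulrDl mul1r addrAC.
  apply: le_trans (hstep Z); apply: lerD; last first.
    by rewrite ler_wpM2l//; apply: (gm n.+1).
  rewrite /draw 2!mulr_sumr -big_split/=.
  apply: ler_sum => T _; apply: le_trans (_ : _ <= w T * _) (ler_wpM2l (w0 T) (IH _)).
  by rewrite le_eqVlt; apply/orP; left; apply/eqP; ring.
apply: le_trans (_ : h set0 <= _); last by rewrite /h setI0 cards0 subn0.
apply: le_trans (claim m set0); rewrite lerDl mul1r.
by apply: iter_draw_ge0 => Z; exact: ler0n.
Qed.

End Sampling.

Section Lift.
Variables (R : realFieldType) (U : finType).
Implicit Types (F : {set {set U}}) (S T V X Y Z : {set U}).

Lemma exists_subset_card X s : (s <= #|X|)%N ->
  exists2 Y : {set U}, Y \subset X & #|Y| = s.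
Proof.
rewrite -bin_gt0 -cards_draws => /card_gt0P[Y].
by rewrite inE => /andP[YX /eqP Ys]; exists Y.
Qed.

(* The union Z of m sets drawn from lam meets each member of F in at least s points
   with probability at least 1/2, and has few traces on F; each Y is given twice
   the probability that it is the s-subset chosen in some large trace on Z. *)
Lemma lift_fractional_cover F d t s m (lam : {set U} -> R) :
    (0 < s)%N -> (VC F <= d)%N -> (forall T, 0 <= lam T) ->
    (forall T, lam T != 0 -> #|T| = t) -> 0 < \sum_T lam T ->
    (forall S V, S \in F -> V \subset S -> (#|V| < s)%N ->
      1 / 2 <= \sum_(T : {set U} | (T \subset S) && ~~ (T \subset V)) lam T) ->
    4 * (\sum_T lam T) * s%:R <= m%:R ->
  exists lam' : {set U} -> R,
    [/\ forall Y, 0 <= lam' Y, forall Y, lam' Y != 0 -> #|Y| = s,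
        forall S, S \in F -> 1 <= \sum_(Y : {set U} | Y \subset S) lam' Y &
        \sum_Y lam' Y <= 2 * ((m * t).+1 ^ d)%:R].
Proof.
move=> s0 Fd lam0 lamt N0 Fhit ms; set N := \sum_T lam T in N0 ms.
pose w T := N^-1 * lam T.
have w0 T : 0 <= w T by rewrite mulr_ge0// invr_ge0 ltW.
have w1 : \sum_T w T = 1 by rewrite -mulr_sumr mulVf// gt_eqF.
have wt T : w T != 0 -> #|T| = t by rewrite mulf_eq0 => /norP[_ /lamt].
pose sub X : {set U} := odflt set0 [pick Y : {set U} | (Y \subset X) && (#|Y| == s)].
have subP X : (s <= #|X|)%N -> sub X \subset X /\ #|sub X| = s.
  move=> /exists_subset_card[Y YX Ys]; rewrite /sub.
  case: pickP => [Y' /andP[? /eqP ?] //|/(_ Y)]; by rewrite YX Ys eqxx.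
pose C Z := [set sub X | X in [set X in [set S :&: Z | S in F] | (s <= #|X|)%N]].
have CP Y Z : Y \in C Z -> #|Y| = s.
  by move=> /imsetP[X]; rewrite inE => /andP[_ /subP[_ ?]] ->.
pose c Y Z : R := (Y \in C Z)%:R.
pose lam' Y := 2 * iter m (draw w) (c Y) set0.
have it0 Y : 0 <= iter m (draw w) (c Y) set0.
  by apply: iter_draw_ge0 => // Z; exact: ler0n.
exists lam'; split.
- by move=> Y; rewrite mulr_ge0.
- move=> Y; apply: contra_neq_eq => Ys; rewrite /lam'.
  suff -> : iter m (draw w) (c Y) set0 = 0 by rewrite mulr0.
  apply/eqP; rewrite eq_le it0 andbT -[leRHS](iter_draw_const w1 m 0 set0).
  apply: iter_draw_le => // Z; rewrite /c lern0 eqb0.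
  by apply: contra Ys => /CP ->.
(* Either [Z] misses [S], meeting it in fewer than [s] points, or the subset chosen in the trace
   [S :&: Z] counts for [S]. It remains to bound the probability of a miss by 1/2. *)
- move=> S SF; rewrite -mulr_sumr -iter_draw_sum.
  set f := (fun Z => _); pose g Z : R := (#|S :&: Z| < s)%N%:R.
  have fg : 1 <= 1 * iter m (draw w) f set0 + 1 * iter m (draw w) g set0.
    rewrite -iter_draw_lin -[leLHS](iter_draw_const w1 m 1 set0).
    apply: iter_draw_le => // Z; rewrite !mul1r /g; case: ltnP => SZ /=.
      by rewrite lerDr sumr_ge0// => Y _; exact: ler0n.
    have [sX _] := subP _ SZ.
    have sS : sub (S :&: Z) \subset S by apply: fintype.subset_trans sX (subsetIl _ _).
    rewrite addr0 /f (bigD1 (sub (S :&: Z)))//= /c imset_f ?lerDl ?sumr_ge0//.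
    by rewrite in_set SZ andbT; apply/imsetP; exists S.
  have e0 : 0 <= (2 * N)^-1 by rewrite invr_ge0 mulr_ge0// ltW.
  (* Weight 1/2 under [lam] becomes [(2 * N)^-1] after normalisation; with [m] at least [4 * N * s]
     a miss then has probability at most 1/2. *)
  have hit : m%:R * (2 * N)^-1 * iter m (draw w) g set0 <= s%:R.
    apply: iter_draw_hit => // V VS Vs.
    rewrite -mulr_sumr invfM mulrC ler_pM2l ?invr_gt0//.
    by apply: le_trans (Fhit S V SF VS Vs); rewrite div1r.
  suff : iter m (draw w) g set0 <= 2^-1 by move: fg; rewrite !mul1r; lra.
  have s0' : 0 < s%:R :> R by rewrite ltr0n.
  have ms' : 2 * s%:R <= m%:R * (2 * N)^-1.
    by rewrite ler_pdivlMr ?mulr_gt0//; apply: le_trans ms; lra.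
  have ig0 : 0 <= iter m (draw w) g set0.
    by apply: iter_draw_ge0 => // Z; exact: ler0n.
  have := le_trans (ler_wpM2r ig0 ms') hit.
  by rewrite mulrAC -ler_pdivlMr// divff ?gt_eqF// mulrC -ler_pdivlMr// div1r.
- rewrite -mulr_sumr -iter_draw_sum ler_wpM2l//.
  have := @iter_draw_card _ _ w w0 w1 m t d (fun Z => \sum_Y c Y Z) wt.
  move=> /(_ _ set0); rewrite cards0 add0n; apply => Z.
  rewrite /c -natr_sum ler_nat (_ : (\sum_Y _)%N = #|C Z|); last first.
    by rewrite -sum1_card [RHS]big_mkcond; apply: eq_bigr => Y _; case: (Y \in C Z).
  apply: leq_trans (leq_trans (sauer_shelah F Z) _); last exact: leq_pexp2l.
  apply: leq_trans (leq_imset_card _ _) _.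
  by apply: subset_leq_card; apply/fintype.subsetP => X; rewrite inE => /andP[].
Qed.

End Lift.

(** * Rounding fractional covers *)

(** Explains the choice of [s], which equals [t * d + d ^ 2 * t]. The number of traces is at most
    [(6 * t * s * N) ^ d]: the exponent [t * d] pays for [N ^ d], and [d ^ 2 * t] pays for the rest
    by [lift_size_bound]. *)
Lemma lift_weight (R : realFieldType) d t s m (N x : R) :
    (0 < d)%N -> (0 < t)%N -> 0 <= x -> x <= 256^-1 -> s = (d.+1 * d * t)%N -> 1 <= N -> N * x ^+ t <= 1 ->
    m%:R <= 4 * N * s%:R + 1 ->
  2 * ((m * t).+1 ^ d)%:R * x ^+ s <= 1.
Proof.
move=> d0 t0 x0 x1 sE N1 Np ms.
have s0 : (0 < s)%N by rewrite sE !muln_gt0 d0 t0.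
have N0 : 0 <= N by lra.
have sr : 1 <= s%:R :> R by rewrite ler1n.
have tr : 1 <= t%:R :> R by rewrite ler1n.
have mt : (m * t).+1%:R <= (6 * t * s)%N%:R * N.
  rewrite -natr1 !natrM.
  have h1 : m%:R <= 5 * N * s%:R :> R by nra.
  have h2 : 1 <= N * s%:R * t%:R.
    by rewrite -[leLHS]mulr1 -[leLHS]mulr1 !ler_pM.
  have h3 := ler_wpM2r (ler0n R t) h1; lra.
rewrite natrX.
apply: (@le_trans _ _ (2 * ((6 * t * s)%N%:R * N) ^+ d * x ^+ s)).
  rewrite ler_wpM2r ?exprn_ge0// ler_wpM2l//.
  by apply: lerXn2r; rewrite ?nnegrE ?mulr_ge0.
have sD : s = (t * d + d ^ 2 * t)%N by rewrite sE mulSn mulnDl -mulnn (mulnC t).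
rewrite [X in x ^+ X]sD exprD exprM exprMn.
set c := (6 * t * s)%N.
apply: (@le_trans _ _ ((2 * c ^ d)%N%:R * (N * x ^+ t) ^+ d * x ^+ (d ^ 2 * t))).
  by rewrite natrM natrX exprMn le_eqVlt; apply/orP; left; apply/eqP; ring.
apply: (@le_trans _ _ ((2 * c ^ d)%N%:R * 1 * 256^-1 ^+ (d ^ 2 * t))).
  rewrite ler_pM ?mulr_ge0 ?exprn_ge0 ?mulr_ge0 ?exprn_ge0//.
    by rewrite ler_wpM2l// exprn_ile1// mulr_ge0// exprn_ge0.
  by apply: lerXn2r; rewrite ?nnegrE ?invr_ge0.
rewrite mulr1 exprVn ler_pdivrMr ?exprn_gt0// mul1r -natrX ler_nat /c sE.
exact: lift_size_bound.
Qed.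

Section Homogeneous.
Variables (R : realType) (U : finType).
Implicit Types (F G : {set {set U}}) (S T V X Y Z : {set U}).

(** Below, [lam] has cost at most 1 at level [256 * p], hence at most [256 ^ - t] at [p]. The second
    256 in [p1] is the slack for [lift_weight], and [dk] bounds the size of heavy sets for
    [cover_bounded]. *)
Variables (d k : nat) (p q : R).
Hypotheses (d0 : (0 < d)%N) (dk : (d.+1 * d <= 2 ^ k)%N).
Hypotheses (p0 : 0 < p) (p1 : 256 * (256 * p) <= 1).
Hypotheses (q0 : 0 <= q) (qp : 256 * k.+1%:R * q <= p).

Let x0 : 0 <= 256 * p. Proof. exact: mulr_ge0 (ler0n _ _) (ltW p0). Qed.

Let x1 : 256 * p <= 256^-1.
Proof. by rewrite -[leRHS]mul1r ler_pdivlMr ?ltr0n// [_ * 256]mulrC. Qed.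

Let q1 : 256 * q <= 1.
Proof.
apply: le_trans (_ : p <= 1); last by move: p0 p1; lra.
have k1 : 1 <= k.+1%:R :> R by rewrite ler1n.
apply: le_trans qp; exact: ler_wpM2r q0 _ _ (ler_peMr (ler0n _ _) k1).
Qed.

Lemma homogeneous_small_cover t (lam : {set U} -> R) (H : {set {set U}}) :
    (0 < t)%N -> (forall T, 0 <= lam T) -> (forall T, lam T != 0 -> #|T| = t) ->
    (\sum_T lam T) * (256 * p) ^+ t <= 1 ->
    (forall V, V \in H -> (#|V| <= 2 ^ k * t)%N /\
       1 / 2 <= \sum_(T : {set U} | T \subset V) lam T) ->
  exists2 G, covers G H &
    \sum_(X in G) q ^+ #|X| <= 3 / 16 * 4^-1 ^+ t.
Proof.
move=> t0 lam0 lamt lamp HV.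
(* Doubling [lam] makes it a fractional cover of [H]. The two error terms are then at most 1/8 and
   1/16 of [4^-1 ^+ t]. *)
have [V /HV[] //|T|V /HV[_]|G GH Gq] :=
    cover_bounded q0 q1 t0 (k := k) (T := id) (lam := fun T => 2 * lam T) (H := H).
- by rewrite mulr_ge0.
- by rewrite -mulr_sumr; lra.
exists G => //; apply: le_trans Gq _.
have pw a b : 0 <= a -> 0 <= b -> a <= b -> a ^+ t <= b ^+ t :> R.
  by move=> a0 b0 ab; apply: lerXn2r; rewrite ?nnegrE.
have s1 : \sum_T (2 * lam T) * (256 * k.+1%:R * q) ^+ #|T| <= 2 * 256^-1 ^+ t.
  apply: (@le_trans _ _ (2 * ((\sum_T lam T) * p ^+ t))).
    rewrite mulr_suml mulr_sumr; apply: ler_sum => T _; rewrite -mulrA ler_wpM2l//.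
    have [->|/lamt ->] := eqVneq (lam T) 0; first by rewrite !mul0r.
    by rewrite ler_wpM2l// pw ?mulr_ge0 ?ler0n// ltW.
  rewrite ler_wpM2l ?ler0n// exprVn -[leRHS]div1r ler_pdivlMr ?exprn_gt0 ?ltr0n//.
  by rewrite -mulrA -exprMn mulrC [p * _]mulrC mulrC.
have e1 : 64^-1 ^+ t <= 16^-1 * 4^-1 ^+ t :> R.
  rewrite (_ : 64^-1 = 16^-1 * 4^-1 :> R); last by lra.
  rewrite exprMn ler_wpM2r ?exprn_ge0 ?invr_ge0//.
  by rewrite -[leRHS]expr1 ler_wiXn2l//; lra.
have e2 : 2 ^+ t * 256^-1 ^+ t <= 32^-1 * 4^-1 ^+ t :> R.
  rewrite -exprMn (_ : 2 / 256 = 32^-1 * 4^-1 :> R); last by lra.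
  rewrite exprMn ler_wpM2r ?exprn_ge0 ?invr_ge0//.
  by rewrite -[leRHS]expr1 ler_wiXn2l//; lra.
have e3 : 2 * 64^-1 ^+ t * (1 - 2^-1 ^+ k) <= 2 * 64^-1 ^+ t :> R.
  by rewrite ler_piMr ?mulr_ge0 ?exprn_ge0 ?invr_ge0//.
have e4 := ler_wpM2l (exprn_ge0 t (ler0n R 2)) s1.
lra.
Qed.

(** Induction on [n], a bound on the number of remaining lifts: each one strictly increases [t]. *)
Lemma homogeneous_cover n t F (lam : {set U} -> R) :
    (#|U| < n + t)%N -> (0 < t)%N -> (VC F <= d)%N ->
    (forall T, 0 <= lam T) -> (forall T, lam T != 0 -> #|T| = t) ->
    (forall S, S \in F -> 1 <= \sum_(T : {set U} | T \subset S) lam T) ->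
    (\sum_T lam T) * (256 * p) ^+ t <= 1 ->
  exists2 G, covers G F & \sum_(X in G) q ^+ #|X| <= 4^-1 ^+ t.
Proof.
have q4 (t' : nat) : 0 <= 4^-1 ^+ t' :> R by rewrite exprn_ge0// invr_ge0.
elim: n t F lam => [|n IH] t F lam Unt t0 Fd lam0 lamt lamF lamp.
  (* Here [t] exceeds the size of [U], so [lam] vanishes and [F] has no member. *)
  exists set0; last by rewrite big_set0.
  move=> S /lamF; rewrite big1 ?ler10// => T _.
  apply/eqP; apply: contraTT Unt => /lamt <-; rewrite -leqNgt.
  exact: max_card.
have [->|/set0Pn[S0 S0F]] := eqVneq F set0.
  by exists set0; rewrite ?big_set0// => S; rewrite inE.
set N := \sum_T lam T in lamp.
have N1 : 1 <= N.
  apply: le_trans (lamF _ S0F) _; rewrite [leLHS]big_mkcond.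
  by apply: ler_sum => T _; case: ifP.
pose s := (d.+1 * d * t)%N.
have ts : (t < s)%N by rewrite ltn_Pmull// (leq_trans _ (leq_pmulr d.+1 d0)).
pose heavy V := 1 / 2 <= \sum_(T : {set U} | T \subset V) lam T.
pose H := [set V : {set U} | (#|V| < s)%N & heavy V].
pose A := [set S in F | ~~ [exists V in H, V \subset S]].
have [V|G1 G1H G1q] := homogeneous_small_cover (H := H) t0 lam0 lamt lamp.
  rewrite inE => /andP[Vs ?]; split=> //.
  by rewrite (leq_trans (ltnW Vs))// leq_mul2r dk orbT.
(* Large enough for the sampling, yet at most [4 * N * s + 1] as [lift_weight] requires. *)
pose m := (Num.truncn (4 * N * s%:R)).+1.
have Ns0 : 0 <= 4 * N * s%:R by rewrite !mulr_ge0//; lra.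
have /andP[m1 m2] := truncn_itv Ns0.
have AF : A \subset F by apply/fintype.subsetP => S; rewrite inE => /andP[].
have [|||||||lam' [lam'0 lam's lam'A lam'N]] :=
    @lift_fractional_cover R U A d t s m lam.
- exact: leq_ltn_trans ts.
- exact: leq_trans (VC_sub AF) Fd.
- exact: lam0.
- exact: lamt.
- exact: lt_le_trans N1.
(* As [V] is not heavy, more than half a unit of the weight inside [S] lies outside [V]. *)
- move=> S V; rewrite inE => /andP[SF /existsPn SH] VS Vs.
  have := SH V; rewrite inE Vs VS andbT /= /heavy -ltNge => Vl.
  have := lamF S SF.
  rewrite (bigID (fun T : {set U} => T \subset V))/=.
  rewrite [X in X + _](eq_bigl (fun T : {set U} => T \subset V)); last first.
    move=> T; case TV: (T \subset V); rewrite ?andbF// andbT.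
    exact: fintype.subset_trans TV VS.
  by move: Vl; lra.
- exact: ltW.
have [||||G2 G2A G2q] := IH s A lam' _ _ _ lam'0 lam's lam'A.
- by apply: leq_trans Unt _; rewrite addSn -addnS leq_add2l.
- exact: leq_ltn_trans ts.
- exact: leq_trans (VC_sub AF) Fd.
- apply: le_trans (lift_weight (m := m) d0 t0 x0 x1 (erefl s) N1 lamp _).
    by rewrite ler_wpM2r// exprn_ge0.
  by rewrite /m -[leLHS]natr1 lerD2r.
exists (G1 :|: G2).
  move=> S SF; have [SA|] := boolP (S \in A).
    by have [X XG XS] := G2A S SA; exists X; rewrite // inE XG orbT.
  rewrite inE SF negbK => /existsP[V /andP[VH VS]].
  have [X XG XV] := G1H V VH; exists X; first by rewrite inE XG.
  exact: fintype.subset_trans XV VS.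
apply: le_trans (sum_setU_le _ _ _) _; first by move=> X; rewrite exprn_ge0.
apply: le_trans (lerD G1q G2q) _.
(* The two covers together cost at most 3/16 + 1/4 of [4^-1 ^+ t]. *)
have : 4^-1 ^+ s <= 4^-1 ^+ t.+1 :> R by apply: ler_wiXn2l => //; lra.
rewrite exprS; have := q4 t; lra.
Qed.

End Homogeneous.

Lemma covers_union (R : realFieldType) (U : finType) (q : R)
    (F_ : nat -> {set {set U}}) : 0 <= q ->
    (forall t, exists2 G, covers G (F_ t) & \sum_(X in G) q ^+ #|X| <= 4^-1 ^+ t.+1) ->
  forall n, exists2 G, (forall t, (t < n)%N -> covers G (F_ t)) &
    \sum_(X in G) q ^+ #|X| <= 3^-1 * (1 - 4^-1 ^+ n).
Proof.
move=> q0 FG; elim=> [|n [G1 G1F G1q]].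
  by exists set0; rewrite // big_set0 expr0 subrr mulr0.
have [G2 G2F G2q] := FG n; exists (G1 :|: G2).
  move=> t; rewrite ltnS leq_eqVlt => /orP[/eqP ->|tn] S SF.
    by have [X XG XS] := G2F S SF; exists X; rewrite // inE XG orbT.
  by have [X XG XS] := G1F t tn S SF; exists X; rewrite // inE XG.
apply: le_trans (sum_setU_le _ _ _) _; first by move=> X; rewrite exprn_ge0.
apply: le_trans (lerD G1q G2q) _; rewrite exprS; move: (4^-1 ^+ n) => x; lra.
Qed.

Lemma sum_half_pow (R : realFieldType) n :
  \sum_(i < n) 2^-1 ^+ i.+2 = 2^-1 * (1 - 2^-1 ^+ n) :> R.
Proof.
elim: n => [|n IH]; first by rewrite big_ord0 expr0 subrr mulr0.
rewrite big_ord_recr/= IH !exprS; move: (2^-1 ^+ n) => x; lra.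
Qed.

(** With [u] the rounded-up logarithm, [2 ^ u.-1] is below [d.+1]. Writing [2 * u + 1] as
    [2 * u.-1 + 3] and using [ln 2 <= ln d.+1] gives 2 + 3 = 5. *)
Lemma up_log2_le_ln (R : realType) d : (0 < d)%N ->
  (2 * up_log 2 d.+1).+1%:R <= 5 / ln 2 * ln d.+1%:R :> R.
Proof.
move=> d0; have ln2 : 0 < ln 2 :> R by rewrite ln_gt0// ltr1n.
have u0 : (0 < up_log 2 d.+1)%N by rewrite up_log_gt0.
have lnd : ln 2 <= ln d.+1%:R :> R by rewrite ler_ln ?posrE ?ltr0n// ler_nat.
have : ln (2 ^+ (up_log 2 d.+1).-1) <= ln d.+1%:R :> R.
  rewrite ler_ln ?posrE ?exprn_gt0 ?ltr0n// -natrX ler_nat ltnW//.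
  exact: up_log_gtn.
rewrite lnXn// -[leLHS]mulr_natl => ud.
rewrite mulrAC ler_pdivlMr//.
have -> : (2 * up_log 2 d.+1).+1 = (2 * (up_log 2 d.+1).-1 + 3)%N by lia.
rewrite natrD natrM; lra.
Qed.

(** * From general to homogeneous fractional covers *)

Section Thresholds.
Variables (R : realType) (U : finType).
Implicit Types (F : {set {set U}}) (S T : {set U}).

(** Pigeonhole over sizes: the thresholds [2^-1 ^+ t.+2] add up to less than 1/2, and the empty set
    carries at most 1/2. *)
Lemma size_slice (lam : {set U} -> R) (S : {set U}) :
    lam set0 <= 1 / 2 -> 1 <= \sum_(T : {set U} | T \subset S) lam T ->
  exists2 t, (t < #|U|)%N &
    2^-1 ^+ t.+2 <= \sum_(T : {set U} | (T \subset S) && (#|T| == t.+1)) lam T.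
Proof.
move=> l0 lS; pose a t := \sum_(T : {set U} | (T \subset S) && (#|T| == t)) lam T.
suff /existsP[t ta] : [exists t : 'I_#|U|, 2^-1 ^+ t.+2 <= a t.+1] by exists t.
apply: contraT => /existsPn at_lt.
suff : \sum_(T : {set U} | T \subset S) lam T < 1 by rewrite ltNge lS.
rewrite (partition_big (fun T => inord #|T| : 'I_#|U|.+1) xpredT)//=.
rewrite (eq_bigr (fun t : 'I_#|U|.+1 => a t)); last first.
  move=> t _; apply: eq_bigl => T.
  by rewrite -val_eqE /= inordK// ltnS max_card.
rewrite big_ord_recl [a _](_ : _ = lam set0); last first.
  rewrite /a (eq_bigl (pred1 set0)) ?big_pred1_eq// => T.
  rewrite cards_eq0 /= andbC; case: eqP => //= ->; exact: sub0set.
have : \sum_(i < #|U|) a (lift ord0 i) <= \sum_(i < #|U|) 2^-1 ^+ i.+2.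
  by apply: ler_sum => t _; rewrite ltW// ltNge at_lt.
rewrite sum_half_pow => h.
have : 0 < 2^-1 ^+ #|U| :> R by rewrite exprn_gt0// invr_gt0.
move: h l0; lra.
Qed.

Lemma qf_admissible_q_admissible F d p : (0 < d)%N -> (VC F <= d)%N -> 0 < p ->
  @qf_admissible R U F p ->
  @q_admissible R U F (p / (256 * 256 * 256 * (2 * up_log 2 d.+1).+1%:R)).
Proof.
move=> d0 Fd p0 [/andP[_ p1] [lam [lam0 lamF] lamp]].
set k := (2 * up_log 2 d.+1)%N.
have k1 : 1 <= k.+1%:R :> R by rewrite ler1n.
have [K KE] : exists K : R, K = 256 by exists 256.
have K1 : 2 <= K by rewrite KE ler_nat.
rewrite -KE; set q := _ / _.
(* Two of the three factors 256 separate [p'] from [p]; the third, with [k.+1], separates [q] from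
   [p']. *)
pose p' := p / (K * K).
have qE : K * k.+1%:R * q = p' by rewrite /q /p'; field; lra.
have K0 : 0 < K by lra.
have p'0 : 0 < p' by rewrite divr_gt0// mulr_gt0.
have q0 : 0 <= q by rewrite divr_ge0 ?(ltW p0)// !mulr_ge0// ltW.
have Kk1 : 1 <= K * k.+1%:R by rewrite mulr_ege1//; lra.
have p'1 : K * (K * p') <= 1.
  by rewrite mulrA /p' mulrC mulfVK// mulf_neq0// gt_eqF.
have p'le : p' <= 1.
  apply: le_trans p'1; rewrite mulrA ler_peMl ?(ltW p'0)// mulr_ege1//; lra.
have q1 : q <= 1 by apply: le_trans p'le; rewrite -qE ler_peMl.
split; first by rewrite q0.
have dk : (d.+1 * d <= 2 ^ k)%N.
  rewrite /k (mulnC 2%N) expnM -mulnn; apply: leq_mul; first exact: up_logP.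
  by apply: leq_trans (leqnSn d) _; exact: up_logP.
(* The slice of size [t.+1], rescaled by the inverse of its threshold in [size_slice]. One factor
   [K] in the level pays for this: [2 ^+ t.+2 / K ^+ t.+1] is at most 2, and [lam] costs at most
   1/2. *)
pose lam_ t (T : {set U}) := if #|T| == t.+1 then 2 ^+ t.+2 * lam T else 0.
pose F_ t := [set S in F | 1 <= \sum_(T : {set U} | T \subset S) lam_ t T].
have FG t : exists2 G, covers G (F_ t) & \sum_(X in G) q ^+ #|X| <= 4^-1 ^+ t.+1.
  apply: (@homogeneous_cover R U d k p' q d0 dk p'0 _ q0 _ #|U| t.+1 (F_ t) (lam_ t)).
  - by rewrite -KE.
  - by rewrite -KE qE.
  - by rewrite addnS ltnS leq_addr.
  - by [].
  - apply: leq_trans (VC_sub _) Fd.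
    by apply/fintype.subsetP => S; rewrite inE => /andP[].
  - by move=> T; rewrite /lam_; case: ifP => // _; rewrite mulr_ge0 ?exprn_ge0.
  - by move=> T; rewrite /lam_; case: (#|T| =P t.+1) => //; rewrite eqxx.
  - by move=> S; rewrite inE => /andP[].
  rewrite -KE; have -> : K * p' = p / K by rewrite /p'; field; lra.
  have h0 : 0 <= 2 ^+ t.+2 * K^-1 ^+ t.+1 :> R.
    by rewrite mulr_ge0 ?exprn_ge0 ?invr_ge0// ltW.
  apply: (@le_trans _ _ (2 ^+ t.+2 * K^-1 ^+ t.+1 * \sum_T lam T * p ^+ #|T|)).
    rewrite mulr_suml mulr_sumr; apply: ler_sum => T _; rewrite /lam_.
    case: eqP => [->|_]; last first.
      by rewrite mul0r; exact: mulr_ge0 h0 (mulr_ge0 (lam0 T) (exprn_ge0 _ (ltW p0))).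
    by rewrite exprMn le_eqVlt; apply/orP; left; apply/eqP; ring.
  have h : 2 ^+ t.+2 * K^-1 ^+ t.+1 <= 2 :> R.
    rewrite exprS -mulrA -exprMn ler_piMr// exprn_ile1 ?divr_ge0 ?(ltW K0)//.
    by rewrite ler_pdivrMr// mul1r.
  apply: le_trans (ler_wpM2l h0 lamp) _; lra.
have [G GF Gq] := covers_union q0 FG #|U|.
exists G; last first.
  apply: le_trans Gq _; have : 0 <= 4^-1 ^+ #|U| :> R by rewrite exprn_ge0 ?invr_ge0.
  by move: (4^-1 ^+ _) => x; lra.
(* The empty set enters the cost with factor [p ^+ 0], which is 1. *)
have l0 : lam set0 <= 1 / 2.
  apply: le_trans lamp; rewrite (bigD1 set0)//= cards0 mulr1 lerDl.
  by apply: sumr_ge0 => T _; rewrite mulr_ge0 ?exprn_ge0// ltW.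
move=> S SF; have [t tU tS] := size_slice l0 (lamF S SF).
apply: (GF t tU); rewrite inE SF /=.
have := ler_wpM2l (exprn_ge0 t.+2 (ler0n R 2)) tS.
rewrite -exprMn divff// expr1n => /le_trans; apply.
rewrite mulr_sumr [leLHS]big_mkcond [leRHS]big_mkcond; apply: ler_sum => T _.
by rewrite /lam_; case: (T \subset S) => //=; case: eqP.
Qed.

End Thresholds.

Theorem corollary1p2 (R : realType) :
  exists2 C : R, 0 < C &
    forall (U : finType) (F : {set {set U}}) (d : nat),
      set0 \notin F -> F != set0 -> (1 <= d)%N -> (VC F <= d)%N ->
      q R F <= qf R F /\ qf R F <= C * q R F * ln (d.+1%:R).
Proof.
have ln2 : 0 < ln 2 :> R by rewrite ln_gt0// ltr1n.
have [K KE] : exists K : R, K = 256 * 256 * 256 by exists (256 * 256 * 256).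
have K0 : 0 < K by rewrite KE; lra.
exists (K * (5 / ln 2)); first by rewrite mulr_gt0// divr_gt0.
move=> U F d F0 _ d0 Fd.
have [qF q_ub] := @q_largest R U F F0; have [qfF qf_ub] := @qf_largest R U F F0.
split; first by apply: qf_ub; apply: q_admissible_qf.
have q0 : 0 <= q R F by apply: q_ub; apply: q_admissible0.
have [qf0|qf_gt0] := leP (qf R F) 0.
  apply: le_trans qf0 _; rewrite !mulr_ge0 ?ln_ge0 ?ler1n ?invr_ge0// ltW//.
(* Since [qf R F] is itself admissible, its rescaling is admissible for [q] and hence at most
   [q R F]. *)
have := q_ub _ (qf_admissible_q_admissible d0 Fd qf_gt0 qfF).
rewrite -KE ler_pdivrMr ?mulr_gt0 ?ltr0n// => /le_trans; apply.
have h := ler_wpM2l (mulr_ge0 (ltW K0) q0) (up_log2_le_ln R d0).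
by rewrite mulrCA mulrA; apply: le_trans h _; rewrite le_eqVlt; apply/orP; left; apply/eqP; ring.
Qed.
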